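(* Let $p$ be a prime and $G=\mathbb{Z}_{p^2}\times\mathbb{Z}_p$. A subset $A\subset G$ is a spectral set if and only if it is a tile of $G$ by translation.
   Context: $\mathbb{Z}_N=\mathbb{Z}/N\mathbb{Z}$. For $b=(b_1,b_2)\in G$ let $\chi_b$ be the character $\chi_b(a_1,a_2)=e^{2\pi i(a_1b_1/p^2+a_2b_2/p)}$; every character of $G$ is of this form. A nonempty set $A\subset G$ is a spectral set if there is $B\subset G$ such that $\{\chi_b|_A: b\in B\}$ is an orthogonal basis of $L^2(A)$ (functions on $A$ with counting measure); $B$ is then called a spectrum of $A$. A set $A\subset G$ is a tile if there is $T\subset G$ such that every element of $G$ can be written uniquely as $a+t$ with $a\in A$, $t\in T$ (i.e. $A\oplus T=G$). *)

(* Defs.v *)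
From HB Require Import structures.
From mathcomp Require Import all_boot all_order all_algebra all_field.
Set Implicit Arguments. Unset Strict Implicit. Unset Printing Implicit Defensive.
Import GRing.Theory Num.Theory.
Local Open Scope ring_scope.

(* G = Z_{p^2} x Z_p  (p prime, so both moduli are >= 2) *)
Notation G p := ('Z_(p ^ 2) * 'Z_p)%type.

(* e^{2 pi i / N} in algC: N.-root (-1) has minimal argument pi/N, so its
   square is exp(2 pi i / N). *)
Definition eN (N : nat) : algC := (N.-root (-1)) ^+ 2.

(* chi_b(a) = e^{2 pi i (a1 b1 / p^2 + a2 b2 / p)}
            = eN(p^2)^(a1 b1 + p a2 b2) *)
Definition chi (p : nat) (b a : G p) : algC :=
  eN (p ^ 2) ^+ ((val a.1 * val b.1) + p * (val a.2 * val b.2))%N.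

(* B is a spectrum of A: {chi_b|_A : b in B} is an orthogonal basis of L^2(A)
   (counting measure): pairwise orthogonal and spanning. *)
Definition is_spectrum (p : nat) (A B : {set G p}) : Prop :=
  (forall b b', b \in B -> b' \in B -> b != b' ->
     \sum_(a in A) chi b a * (chi b' a)^* = 0)
  /\ (forall f : G p -> algC, exists c : G p -> algC,
        forall a, a \in A -> f a = \sum_(b in B) c b * chi b a).

Definition spectral_set (p : nat) (A : {set G p}) : Prop :=
  A != set0 /\ exists B : {set G p}, is_spectrum A B.

Definition tile (p : nat) (A : {set G p}) : Prop :=
  exists T : {set G p}, forall x : G p,
    exists! u : G p * G p, [/\ u.1 \in A, u.2 \in T & u.1 + u.2 = x].

(* Main.v *)
Require Import Defs.
From HB Require Import structures.
From mathcomp Require Import all_boot all_order all_algebra all_field.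
From mathcomp Require Import cyclic.
From mathcomp Require Import ring lra zify.

(* Let Z(A) be the zero set of the Fourier transform [ft A]. It is stable under
   multiples prime to p, and if it is nonempty then p divides |A|. Every B with
   all nonzero differences in Z(A) has |B| <= |A|, and is a spectrum of A
   exactly when |B| = |A|; and A + T = G as soon as |A||T| = |G| and Z(A), Z(T)
   together contain every b <> 0. If |A| = p, one zero b suffices: its multiples
   0, b, ..., (p-1) b form a spectrum, and there is a T of size p^2 vanishing
   outside the class of b.
   If A is spectral with |A| > p (by pigeonhole), or A is a tile with
   |A| = p^2 (by the bound |B| <= |A| applied to its complement), then Z(A)
   meets the differences of every set of p^2 elements. Testing this on the
   grids {i g + j h : i, j < p} forces Z(A) to contain all the differences of
   one such grid and to cover, together with Z(T) for some
   T = {i t : i < p}, all b <> 0; so when |A| = p^2 the grid is a spectrum and T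
   a tiling complement. *)

Set Implicit Arguments.
Unset Strict Implicit.
Unset Printing Implicit Defensive.
Import Order.TTheory GRing.Theory Num.Theory.
Local Open Scope ring_scope.

(** * Primitivity of the root of unity [eN n] *)

(** For points [(a, b)] and [(c, s)] of the upper half circle, [b * c - a * s] is the sine of the
    difference of their arguments, and the argument decreases as the abscissa grows. *)
Lemma unit_circle_cross_le (R : realDomainType) (a b c s : R) :
  a ^+ 2 + b ^+ 2 = 1 -> c ^+ 2 + s ^+ 2 = 1 -> 0 <= b -> 0 <= s -> a <= c ->
  a * s <= b * c.
Proof.
move=> ab cs b0 s0 ac; rewrite leNgt; apply/negP => lt.
have [c0|c0] := lerP 0 c.
  have a0 : 0 < a by rewrite ltNge; apply/negP => a0; nra.
  have sb : s <= b by rewrite -ler_sqr //; nra.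
  nra.
have bs : b <= s by rewrite -ler_sqr //; nra.
nra.
Qed.

Lemma Im_mul_conj_ge0 (y w : algC) :
  `|y| = 1 -> `|w| = 1 -> 0 <= 'Im y -> 0 <= 'Im w -> 'Re y <= 'Re w ->
  0 <= 'Im (y * w^*).
Proof.
move=> y1 w1 y0 w0 yw.
rewrite ImM Re_conj Im_conj mulrN addrC subr_ge0 [X in _ <= X]mulrC.
(* [algC] is only partially ordered, so the inequality is moved to its real subfield [algR]. *)
pose re z : algR := in_algR (Creal_Re z); pose im z : algR := in_algR (Creal_Im z).
have unit z : `|z| = 1 -> re z ^+ 2 + im z ^+ 2 = 1.
  by move=> z1; apply: val_inj; rewrite /= -!expr2 -normC2_Re_Im z1 expr1n.
exact: (unit_circle_cross_le (unit y y1) (unit w w1) y0 w0 yw).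
Qed.

Lemma unit_Im0 (z : algC) : `|z| = 1 -> 'Im z = 0 -> z = 1 \/ z = -1.
Proof.
move=> z1 im0; have := normC2_Re_Im z.
rewrite z1 expr1n im0 expr0n addr0 => /esym/eqP.
by rewrite sqrf_eq1 [z in z = 1 \/ z = _]Crect im0 mulr0 addr0 => /orP[]/eqP; auto.
Qed.

Section PrincipalRoot.

Variable n : nat.
Hypothesis n_gt1 : (1 < n)%N.

Let w : algC := n.-root (-1).
Let n_gt0 : (0 < n)%N := ltnW n_gt1.

Lemma rootCN1_exp : w ^+ n = -1. Proof. exact: rootCK. Qed.

Lemma norm_expN1 (y : algC) : y ^+ n = -1 -> `|y| = 1.
Proof.
move=> yn; have /eqP : `|y| ^+ n = 1 by rewrite -normrX yn normrN1.
by rewrite pexpr_eq1 // => /eqP.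
Qed.

Lemma conj_expN1 (y : algC) : y ^+ n = -1 -> y^* ^+ n = -1.
Proof. by move=> yn; rewrite -rmorphXn /= yn rmorphN rmorph1. Qed.

(* Rotating [y] clockwise by twice the argument of [w] cannot jump over the arc
   between [w^*] and [w], which contains no other solution of [y ^+ n = -1]. *)
Lemma rootCN1_rotate (y : algC) : 0 < 'Im w -> y ^+ n = -1 -> 0 <= 'Im y ->
  let u := y * w^* * w^* in
  y = w \/ [/\ u ^+ n = -1, 0 <= 'Im u & 'Re y < 'Re u].
Proof.
move=> w0 yn y0 u; have wn := rootCN1_exp.
have y1 := norm_expN1 yn; have w1 := norm_expN1 wn.
have ww : w^* * w = 1 by rewrite mulrC -normCK w1 expr1n.
have un : u ^+ n = -1 by rewrite !exprMn yn conj_expN1 // mulrNN mulr1 mulrN1.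
have u1 := norm_expN1 un.
pose q := y * w^*.
have q1 : `|q| = 1 by rewrite normrM norm_conjC y1 w1 mulr1.
have q0 : 0 <= 'Im q.
  by apply: Im_mul_conj_ge0 => //; [exact: ltW | exact: rootC_Re_max].
have yq : y = q * w by rewrite /q -mulrA ww mulr1.
move: q0; rewrite le_eqVlt => /predU1P[/esym im0 | q0].
  case: (unit_Im0 q1 im0) => qE; first by left; rewrite yq qE mul1r.
  by move: y0; rewrite yq qE mulN1r raddfN /= oppr_ge0 lt_geF.
right; split => //.
  (* Otherwise the conjugate of [u] is a root in the upper half plane, with argument at least that
     of [w]; then [u * w] has imaginary part at most 0, whereas [u * w = q]. *)
  rewrite real_leNgt ?real0 ?Creal_Im //; apply/negP => u0.
  have uc0 : 0 <= 'Im u^* by rewrite Im_conj oppr_ge0 ltW.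
  have uw := rootC_Re_max n_gt0 (conj_expN1 un) uc0.
  have := Im_mul_conj_ge0 _ w1 uc0 (ltW w0) uw; rewrite norm_conjC => /(_ u1).
  by rewrite -rmorphM Im_conj /u -!mulrA ww mulr1 oppr_ge0 lt_geF.
have -> : u = q * w^* by [].
rewrite yq !ReM Re_conj Im_conj.
rewrite ltrD2l ltrN2 mulrN; apply: lt_trans (mulr_gt0 q0 w0).
by rewrite oppr_lt0 mulr_gt0.
Qed.

(** Rotate [y] repeatedly by the inverse square of [w]. The real part strictly increases until [w]
    is met, but [n] rotations would return to [y] because [w ^+ (2 * n) = 1]. *)
Lemma rootCN1_power (y : algC) :
  y ^+ n = -1 -> 0 <= 'Im y -> exists k, y = w ^+ k.
Proof.
move=> yn y0; have wn := rootCN1_exp; have w1 := norm_expN1 wn.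
have ww : w^* * w = 1 by rewrite mulrC -normCK w1 expr1n.
have := Im_rootC_ge0 (-1 : algC) n_gt1; rewrite -/w le_eqVlt.
case/predU1P => [/esym w0 | w0].
  (* A real [w] is -1, and as its real part is maximal, [y] is -1 too. *)
  have neq1 : w <> 1.
    by move=> E; move/eqP: wn; rewrite E expr1n eq_sym eqNr oner_eq0.
  have {neq1} wE : w = -1 by case: (unit_Im0 w1 w0).
  have reyw := rootC_Re_max n_gt0 yn y0.
  exists 1; rewrite expr1 wE.
  have ey := normC2_Re_Im y; rewrite (norm_expN1 yn) expr1n in ey.
  have rey : 'Re y <= -1.
    by apply: le_trans reyw _; rewrite -/w wE; rewrite (Creal_ReP _ _) ?rpredN ?rpred1.
  have : 'Im y ^+ 2 <= 0.
    rewrite -(lerD2l ('Re y ^+ 2)) -ey addr0.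
    have ney : 1 <= - 'Re y by rewrite lerNr.
    by rewrite -sqrrN expr_ge1 // (le_trans ler01 ney).
  rewrite real_exprn_even_le0 ?Creal_Im //= => /eqP im0.
  case: (unit_Im0 (norm_expN1 yn) im0) => // yE.
  by move/eqP: yn; rewrite yE expr1n eq_sym eqNr oner_eq0.
pose v k := y * (w^* * w^*) ^+ k.
have vS k : v k.+1 = v k * w^* * w^* by rewrite /v exprSr !mulrA.
have back k : v k * (w * w) ^+ k = y.
  by rewrite /v -mulrA -exprMn mulrACA ww mulr1 expr1n mulr1.
have climb k : (exists j, y = w ^+ j) \/
    [/\ v k ^+ n = -1, 0 <= 'Im (v k) & (0 < k)%N -> 'Re y < 'Re (v k)].
  elim: k => [|k [|[vn v0 rev]]]; [|by left|].
    by right; rewrite /v expr0 mulr1.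
  have [vw | [un u0 reu]] := rootCN1_rotate w0 vn v0.
    by left; exists (k.*2.+1); rewrite -(back k) vw -expr2 -exprM mul2n -exprS.
  right; rewrite vS; split => // _; apply: le_lt_trans reu.
  by case: k rev {vn v0 un u0} => [_|k /(_ isT)/ltW //]; rewrite /v expr0 mulr1.
have [//|[_ _ /(_ n_gt0)]] := climb n.
by rewrite /v exprMn conj_expN1 // mulrNN mulr1 mulr1 ltxx.
Qed.

(** A primitive root of order [2 * n], conjugated if needed into the upper half plane, is a power of
    [w]. So [w] has order [2 * n] and its square has order [n]. *)
Lemma eN_primitive : n.-primitive_root (eN n).
Proof.
have [z zP] := C_prim_root_exists (isT : (0 < 2 * n.-1.+1)%N).
rewrite prednK // in zP.
have prim_w (y : algC) : (2 * n).-primitive_root y -> 0 <= 'Im y ->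
    (2 * n).-primitive_root w.
  move=> yP y0; have yn : y ^+ n = -1.
    have /eqP := prim_expr_order yP; rewrite mulnC exprM sqrf_eq1.
    case/orP => /eqP // /eqP; rewrite -(prim_order_dvd yP).
    by move/(dvdn_leq n_gt0); rewrite leqNgt ltn_Pmull.
  have [k yw] := rootCN1_power yn y0.
  have w2n : w ^+ (2 * n) = 1 by rewrite mulnC exprM rootCN1_exp sqrrN expr1n.
  have [m wP mn] := prim_order_exists (prim_order_gt0 zP) w2n.
  suff nm : (2 * n %| m)%N by have /eqP <- : m == (2 * n)%N by rewrite eqn_dvd mn.
  by rewrite (prim_order_dvd yP) yw exprAC (prim_expr_order wP) expr1n.
have {z zP} wP : (2 * n).-primitive_root w.
  have [z0|z0] := real_leP (real0 _) (Creal_Im z); first exact: prim_w zP z0.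
  apply: (prim_w z^*); last by rewrite Im_conj oppr_ge0 ltW.
  by rewrite fmorph_primitive_root.
have := exp_prim_root wP 2.
by rewrite (gcdn_idPl (dvdn_mulr n (dvdnn 2))) mulKn.
Qed.

End PrincipalRoot.

(** * Vanishing sums of powers of a primitive root of order p^2 *)

Section VanishingSums.

Variables (p : nat) (z : algC) (f : nat -> nat).
Hypotheses (p_pr : prime p) (zP : (p ^ 2).-primitive_root z).
Hypothesis f0 : \sum_(i < p ^ 2) (f i)%:R * z ^+ i = 0.

Let Q : {poly rat} := \poly_(i < p ^ 2) (f i)%:R.
Let p_gt0 : (0 < p)%N := prime_gt0 p_pr.

Let horner_Q (x : algC) :
  (map_poly ratr Q).[x] = \sum_(i < p ^ 2) (f i)%:R * x ^+ i.
Proof.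
rewrite (@horner_coef_wide _ (p ^ 2)) ?size_map_poly ?size_poly //.
by apply: eq_bigr => i _; rewrite coef_map coef_poly ltn_ord /= ratr_nat.
Qed.

(** The minimal polynomial of [z] is cyclotomic: it divides [Q] and has [z ^+ k] among its roots. *)
Lemma vanishing_sum_conjugate k :
  coprime k p -> \sum_(i < p ^ 2) (f i)%:R * z ^+ (i * k) = 0.
Proof.
move=> kp; have [m [mE _] mP] := minCpolyP z.
have /dvdpP[r QE] : m %| Q by rewrite -mP /root horner_Q f0.
transitivity ((map_poly ratr Q).[z ^+ k]).
  by rewrite horner_Q; apply: eq_bigr => i _; rewrite mulnC exprM.
rewrite QE rmorphM /= hornerM -mE (minCpoly_cyclotomic zP).
have /eqP -> : root (cyclotomic z (p ^ 2)) (z ^+ k).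
  by rewrite (root_cyclotomic zP) (prim_root_exp_coprime _ zP) coprimeXr.
by rewrite mulr0.
Qed.

(* The minimal polynomial of [z] times ['X^p - 1] is ['X^(p^2) - 1], so
   [('X^p - 1) * Q] is a multiple of ['X^(p^2) - 1] by a cofactor of degree
   less than [p]; compare the coefficients in degree [j]. *)
Lemma vanishing_sum_periodic j : (j + p < p ^ 2)%N -> f (j + p)%N = f j.
Proof.
move=> jp; pose Psi : {poly rat} := \sum_(i < p) ('X^p) ^+ i.
have PsiE : ('X^p - 1) * Psi = 'X^(p ^ 2) - 1.
  by rewrite /Psi -subrX1 -exprM mulnn.
have monX n : (0 < n)%N -> ('X^n - 1 : {poly rat}) \is monic.
  by move=> n0; rewrite -polyC1 monicXnsubC.
have sizeX n : (0 < n)%N -> size ('X^n - 1 : {poly rat}) = n.+1.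
  by move=> n0; rewrite -polyC1 size_XnsubC.
have Psi0 : Psi != 0.
  apply/eqP => E; move: PsiE; rewrite E mulr0 => /esym/eqP.
  by rewrite (negPf (monic_neq0 (monX _ _))) // expn_gt0 p_gt0.
have sPsi : (p + size Psi = (p ^ 2).+1)%N.
  have /(congr1 (fun q : {poly rat} => size q)) := PsiE.
  by rewrite size_monicM ?monX // !sizeX // expn_gt0 p_gt0.
have [m [mE _] mP] := minCpolyP z.
have sm : size m = size Psi.
  have := size_cyclotomic z (p ^ 2).
  rewrite -(minCpoly_cyclotomic zP) mE size_map_poly => ->.
  apply/eqP; rewrite -(eqn_add2l p) sPsi totient_pfactor // expn1 addnS.
  by rewrite -mulSn prednK.
(* [z] is a root of ['X^(p ^ 2) - 1] but not of ['X^p - 1], hence of [Psi]. *)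
have mPsi : m %| Psi.
  rewrite -mP; have : (map_poly ratr (('X^p - 1) * Psi)).[z] = 0 :> algC.
    rewrite PsiE rmorphB rmorph1 /= map_polyXn !hornerE.
    by rewrite (prim_expr_order zP) subrr.
  rewrite rmorphM rmorphB rmorph1 /= map_polyXn hornerM => /eqP.
  rewrite mulf_eq0 !hornerE subr_eq0 -(prim_order_dvd zP).
  by rewrite gtnNdvd //= -{1}[p]expn1 ltn_exp2l ?prime_gt1.
have /eqp_dvdl PsiQ : m %= Psi by rewrite -dvdp_size_eqp // sm.
have /dvdpP[r QE] : Psi %| Q by rewrite -PsiQ -mP /root horner_Q f0.
have sr : (size r <= p)%N.
  have [->|r0] := eqVneq r 0; first by rewrite size_poly0.
  have : (size Q <= p ^ 2)%N by exact: size_poly.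
  have sPsi0 : (0 < size Psi)%N by rewrite size_poly_gt0.
  rewrite QE size_mul //.
  move: sPsi sPsi0; move: (size Psi) (size r) (p ^ 2)%N => a b c; lia.
have /(congr1 (fun q : {poly rat} => q`_(j + p))) :
    ('X^p - 1) * Q = r * ('X^(p ^ 2) - 1).
  by rewrite QE mulrCA PsiE.
(* In degree [j + p] the left side has [f j - f (j + p)], and the right side only a coefficient of
   [r] beyond its size. *)
rewrite mulrBl mulrBr mul1r mulr1 !coefB coefXnM coefMXn jp.
rewrite ltnNge leq_addl /= addnK !coef_poly jp (leq_ltn_trans _ jp) ?leq_addr //.
rewrite (nth_default 0) ?(leq_trans sr) ?leq_addl // subr0 => /eqP.
by rewrite subr_eq0 eqr_nat => /eqP.
Qed.

End VanishingSums.

(** * The character pairing and the Fourier transform *)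

(* The embedding of [Z_p] into [Z_(p^2)] as the multiples of [p]. *)
Definition plift (p : nat) (y : 'Z_p) : 'Z_(p ^ 2) := (p * y)%:R.

(** The exponent a1 b1 / p^2 + a2 b2 / p of the character, multiplied by p^2; it is a symmetric
    biadditive form. *)
Definition pairing (p : nat) (b a : G p) : 'Z_(p ^ 2) :=
  b.1 * a.1 + plift (b.2 * a.2).

Definition ec (p : nat) (x : 'Z_(p ^ 2)) : algC := eN (p ^ 2) ^+ x.

Definition ft (p : nat) (A : {set G p}) (b : G p) : algC :=
  \sum_(a in A) ec (pairing b a).

Section Fourier.

Variable p : nat.
Hypothesis p_pr : prime p.

Let p_gt0 : (0 < p)%N := prime_gt0 p_pr.
Let p_gt1 : (1 < p)%N := prime_gt1 p_pr.
Let p2_gt1 : (1 < p ^ 2)%N. Proof. by rewrite -(exp1n 2) ltn_exp2r. Qed.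
Let zP : (p ^ 2).-primitive_root (eN (p ^ 2)). Proof. exact: eN_primitive. Qed.

Implicit Types (A B T : {set G p}) (a b x : G p).

Lemma natZp_eq0 q k : (1 < q)%N -> ((k%:R : 'Z_q) == 0) = (q %| k)%N.
Proof. by move=> q1; rewrite -val_eqE /= val_Zp_nat. Qed.

Lemma plift_nat k : plift (k%:R : 'Z_p) = (p * k)%:R.
Proof.
rewrite /plift val_Zp_nat //; apply: val_inj; rewrite /= !val_Zp_nat //.
by rewrite -mulnn -!muln_modr modn_mod.
Qed.

Lemma pliftD : {morph @plift p : x y / x + y}.
Proof.
by move=> x y; rewrite -[x]natr_Zp -[y]natr_Zp -natrD !plift_nat mulnDr natrD.
Qed.

Lemma plift0 : plift (0 : 'Z_p) = 0.
Proof. by rewrite /plift muln0. Qed.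

Lemma plift_eq0 (y : 'Z_p) : (plift y == 0) = (y == 0).
Proof.
rewrite natZp_eq0 // -mulnn dvdn_pmul2l // -[y in RHS]natr_Zp natZp_eq0 //.
Qed.

Lemma pliftN : {morph @plift p : x / - x}.
Proof.
by move=> x; apply/eqP; rewrite -subr_eq0 opprK -pliftD addNr plift0.
Qed.

Lemma pairingC b a : pairing b a = pairing a b.
Proof. by rewrite /pairing mulrC [b.2 * _]mulrC. Qed.

Lemma pairingDl b b' a : pairing (b + b') a = pairing b a + pairing b' a.
Proof. by rewrite /pairing !mulrDl pliftD addrACA. Qed.

Lemma pairingDr b a a' : pairing b (a + a') = pairing b a + pairing b a'.
Proof. by rewrite !(pairingC b) pairingDl. Qed.

Lemma pairing0l a : pairing 0 a = 0.
Proof. by rewrite /pairing !mul0r plift0 addr0. Qed.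

Lemma pairing0r a : pairing a 0 = 0.
Proof. by rewrite pairingC pairing0l. Qed.

Lemma pairingNl b a : pairing (- b) a = - pairing b a.
Proof. by apply/eqP; rewrite -subr_eq0 opprK -pairingDl addNr pairing0l. Qed.

Lemma pairingNr b a : pairing b (- a) = - pairing b a.
Proof. by rewrite !(pairingC b) pairingNl. Qed.

Lemma pairingMnl b a k : pairing (b *+ k) a = pairing b a *+ k.
Proof. by elim: k => [|k IH]; rewrite ?pairing0l // !mulrS pairingDl IH. Qed.

Lemma pairingMnr b a k : pairing b (a *+ k) = pairing b a *+ k.
Proof. by rewrite !(pairingC b) pairingMnl. Qed.

Lemma ec_nat k : ec (k%:R : 'Z_(p ^ 2)) = eN (p ^ 2) ^+ k.
Proof. by rewrite /ec val_Zp_nat // (prim_expr_mod zP). Qed.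

Lemma ecD (x y : 'Z_(p ^ 2)) : ec (x + y) = ec x * ec y.
Proof. by rewrite -[x]natr_Zp -[y]natr_Zp -natrD !ec_nat exprD. Qed.

Lemma ec0 : ec (0 : 'Z_(p ^ 2)) = 1. Proof. by []. Qed.

Lemma ecMn (x : 'Z_(p ^ 2)) k : ec (x *+ k) = ec x ^+ k.
Proof. by elim: k => // k IH; rewrite mulrS exprS ecD IH. Qed.

Lemma ec_eq1 (x : 'Z_(p ^ 2)) : (ec x == 1) = (x == 0).
Proof. by rewrite -[x]natr_Zp ec_nat natZp_eq0 // (prim_order_dvd zP). Qed.

Lemma ec_norm (x : 'Z_(p ^ 2)) : `|ec x| = 1.
Proof.
apply/eqP; rewrite -(@pexpr_eq1 _ _ (p ^ 2)) ?expn_gt0 ?p_gt0 // -normrX.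
by rewrite /ec exprAC (prim_expr_order zP) expr1n normr1.
Qed.

Lemma ecN (x : 'Z_(p ^ 2)) : ec (- x) = (ec x)^*.
Proof.
have xx : ec (- x) * ec x = 1 by rewrite -ecD addNr ec0.
by rewrite -[RHS]mul1r -xx -mulrA -normCK ec_norm expr1n mulr1.
Qed.

Lemma chiE b a : chi b a = ec (pairing b a).
Proof.
rewrite /chi -ec_nat natrD natrM !natr_Zp mulrC /pairing; congr (ec (_ + _)).
by rewrite -plift_nat natrM !natr_Zp mulrC.
Qed.

Lemma ft0 A : ft A 0 = #|A|%:R.
Proof.
rewrite /ft (eq_bigr (fun=> 1)) ?sumr_const // => a _.
by rewrite pairing0l ec0.
Qed.

Lemma card_G : #|{: G p}| = (p ^ 3)%N.
Proof. by rewrite card_prod !card_ord !Zp_cast // [RHS]expnSr. Qed.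

Lemma pairing_nondeg x : x != 0 -> exists b, pairing b x != 0.
Proof.
case: x => x1 x2 nz; have [x10|nz1] := eqVneq x1 0; last first.
  by exists (1, 0); rewrite /pairing mul1r mul0r plift0 addr0.
exists (0, 1); rewrite /pairing mul1r mul0r add0r plift_eq0.
by apply: contraNneq nz => /= ->; rewrite x10.
Qed.

Lemma sum_ec_pairing x :
  \sum_b ec (pairing b x) = if x == 0 then (p ^ 3)%:R else 0.
Proof.
have [->|/pairing_nondeg[b0 nz]] := eqVneq x 0.
  by under eq_bigr do rewrite pairing0r ec0; rewrite sumr_const card_G.
(* Translation by [b0] multiplies the sum by [ec (pairing b0 x)], which is not 1. *)
apply/eqP; have /eqP : \sum_b ec (pairing b x) = ec (pairing b0 x) * \sum_b ec (pairing b x).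
  rewrite mulr_sumr (reindex_inj (addrI b0)) /=.
  by apply: eq_bigr => b _; rewrite pairingDl ecD.
rewrite eq_sym -subr_eq0 -{2}[\sum_b _]mul1r -mulrBl mulf_eq0 subr_eq0 ec_eq1.
by rewrite (negPf nz).
Qed.

(** * Orthogonal characters and spectra *)

(** The inner product of [chi b] and [chi b'] on [A] is [ft A (b - b')]. *)
Definition orth A B :=
  forall b b', b \in B -> b' \in B -> b != b' -> ft A (b - b') = 0.

(** In the expanded square, off-diagonal terms contain a zero of [ft A]. For [a] in [A], the term
    [a' = a] alone is the square of [#|B|]; hence [#|B| <= #|A|], and equality kills all other
    terms. *)
Lemma sum_sqr_kernel A B a : orth A B ->
  \sum_(a' in A) `|\sum_(b in B) ec (pairing b (a - a'))| ^+ 2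
    = (#|A| * #|B|)%:R.
Proof.
move=> AB.
transitivity (\sum_(b in B) \sum_(b' in B)
    ec (pairing (b - b') a) * ft A (b' - b)).
  under eq_bigr => a' _ do rewrite normCK rmorph_sum mulr_suml.
  rewrite exchange_big; apply: eq_bigr => b _.
  under eq_bigr => a' _ do rewrite mulr_sumr.
  rewrite exchange_big; apply: eq_bigr => b' _.
  rewrite mulr_sumr; apply: eq_bigr => a' _.
  rewrite /= -ecN -!ecD; congr ec.
  rewrite !(pairingDl, pairingDr, pairingNl, pairingNr); ring.
rewrite mulnC natrM -sumr_const mulr_suml; apply: eq_bigr => b bB.
rewrite (bigD1 b) //= subrr pairing0l ec0 mul1r ft0 big1 ?addr0 ?mul1r //.
by move=> b' /andP[b'B nb]; rewrite AB ?mulr0.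
Qed.

Lemma kernel_diag B a :
  \sum_(b in B) ec (pairing b (a - a)) = #|B|%:R.
Proof.
by under eq_bigr => b _ do rewrite subrr pairing0r ec0; rewrite sumr_const.
Qed.

Lemma orth_card A B : A != set0 -> orth A B -> (#|B| <= #|A|)%N.
Proof.
case/set0Pn => a aA AB; have := sum_sqr_kernel a AB.
rewrite (bigD1 a) //= kernel_diag // normr_nat => E.
have : (#|B| * #|B| <= #|A| * #|B|)%N.
  rewrite -(ler_nat algC) -E -natrX mulnn lerDl sumr_ge0 // => a' _.
  by rewrite exprn_ge0.
by case: #|B| => // k; rewrite leq_pmul2r.
Qed.

Lemma orth_kernel_offdiag A B : orth A B -> #|B| = #|A| ->
  {in A &, forall a a', a != a' -> \sum_(b in B) ec (pairing b (a - a')) = 0}.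
Proof.
move=> AB BA a a' aA a'A aa'; have := sum_sqr_kernel a AB.
rewrite (bigD1 a) //= kernel_diag // normr_nat -natrX BA mulnn.
rewrite -[RHS]addr0 => /addrI/eqP; rewrite psumr_eq0; last first.
  by move=> i _; rewrite exprn_ge0.
move/allP => /(_ a'); rewrite mem_index_enum a'A eq_sym aa' => /(_ isT).
by rewrite expf_eq0 normr_eq0 => /eqP.
Qed.

Lemma orth_spectrum A B : A != set0 -> orth A B -> #|B| = #|A| -> is_spectrum A B.
Proof.
move=> A0 AB BA; split=> [b b' bB b'B bb' | f].
  apply: etrans (AB _ _ bB b'B bb'); apply: eq_bigr => a _.
  by rewrite !chiE -ecN -ecD pairingDl pairingNl.
have nA : #|A|%:R != 0 :> algC by rewrite pnatr_eq0 cards_eq0.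
(* These are the Fourier coefficients of [f] on [A]; the kernel over [B] vanishes off the
   diagonal. *)
exists (fun b => \sum_(a' in A) f a' * (ec (pairing b a'))^* / #|A|%:R).
move=> a aA.
transitivity (\sum_(a' in A) f a' / #|A|%:R * \sum_(b in B) ec (pairing b (a - a'))).
  rewrite (bigD1 a) //= kernel_diag // BA divfK // big1 ?addr0 //.
  by move=> a' /andP[a'A aa']; rewrite (orth_kernel_offdiag AB) ?mulr0 // eq_sym.
under eq_bigr => a' _ do rewrite mulr_sumr.
rewrite exchange_big; apply: eq_bigr => b _; rewrite mulr_suml.
apply: eq_bigr => a' _; rewrite chiE pairingDr pairingNr ecD ecN.
by rewrite !mulrA mulrAC [_ / _ * _]mulrAC.
Qed.

(** For the cardinality, expand the indicator of a point [a] of [A]: orthogonality gives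
    coefficients of the form conjugate of [chi b a] over [#|A|], and evaluation at [a] gives 1 =
    [#|B|] / [#|A|]. *)
Lemma spectrum_orth A B : A != set0 -> is_spectrum A B -> orth A B /\ #|B| = #|A|.
Proof.
move=> A0 [ort span]; have AB : orth A B.
  move=> b b' bB b'B bb'; apply: etrans (ort _ _ bB b'B bb').
  by apply: eq_bigr => a _; rewrite !chiE -ecN -ecD pairingDl pairingNl.
split=> //; have [a aA] := set0Pn _ A0.
have nA : #|A|%:R != 0 :> algC by rewrite pnatr_eq0 cards_eq0.
have [c cP] := span (fun a' => (a' == a)%:R).
have cE b : b \in B -> (ec (pairing b a))^* = c b * #|A|%:R.
  move=> bB.
  transitivity (\sum_(a' in A) (a' == a)%:R * (chi b a')^*).
    rewrite (bigD1 a) //= eqxx mul1r chiE big1 ?addr0 // => a' /andP[_ /negPf->].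
    by rewrite mul0r.
  under eq_bigr => a' a'A do rewrite cP // mulr_suml.
  rewrite exchange_big (bigD1 b) //= [X in _ + X]big1 ?addr0.
    under eq_bigr => a' _ do rewrite -mulrA chiE -normCK ec_norm expr1n mulr1.
    by rewrite sumr_const mulr_natr.
  move=> b' /andP[b'B bb'].
  under eq_bigr => a' _ do rewrite -mulrA.
  by rewrite -mulr_sumr ort ?mulr0.
have /(congr1 (fun u => u * #|A|%:R)) := cP a aA.
rewrite eqxx mul1r mulr_suml => E; apply/eqP; rewrite -(eqr_nat algC) E.
rewrite -sumr_const; apply/eqP; apply: eq_bigr => b bB.
by rewrite mulrAC -cE // chiE mulrC -normCK ec_norm expr1n.
Qed.

Lemma orth_family (I : finType) (s : I -> G p) A : A != set0 ->
  (forall i j, i != j -> ft A (s i - s j) = 0) ->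
  orth A (s @: I) /\ #|s @: I| = #|I|.
Proof.
move=> A0 H; split.
  move=> _ _ /imsetP[i _ ->] /imsetP[j _ ->] nij; apply: H.
  by apply: contraNneq nij => ->.
apply: card_imset => i j sij; apply/eqP; apply/negPn/negP => /H/eqP.
by rewrite sij subrr ft0 pnatr_eq0 cards_eq0 (negPf A0).
Qed.

(** * Tilings and zeros of the Fourier transform *)

Lemma tile_sum A T (F : G p -> algC) :
  (forall x, exists! u : G p * G p, [/\ u.1 \in A, u.2 \in T & u.1 + u.2 = x]) ->
  \sum_(a in A) \sum_(t in T) F (a + t) = \sum_x F x.
Proof.
move=> AT; rewrite pair_big /= (partition_big (fun u : G p * G p => u.1 + u.2) predT) //=.
apply: eq_bigr => x _; have [u [[uA uT ux] uni]] := AT x.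
rewrite (big_pred1 u) ?ux // => v; apply/idP/eqP.
  by case/andP=> /andP[vA vT] /eqP vx; apply/esym/uni.
by move=> ->; rewrite uA uT ux eqxx.
Qed.

(** The product [ft A b * ft T b] is the character sum over the whole group. *)
Lemma tile_card_ft A : tile A ->
  exists T, (#|A| * #|T| = p ^ 3)%N /\
            forall b, b != 0 -> ft A b = 0 \/ ft T b = 0.
Proof.
case=> T AT; exists T; split.
  have := tile_sum (fun=> 1) AT; rewrite !sumr_const card_G => /eqP.
  by rewrite -mulrnA eqr_nat mulnC => /eqP.
move=> b b0; have := tile_sum (fun x => ec (pairing b x)) AT.
under [RHS]eq_bigr => x _ do rewrite pairingC.
rewrite sum_ec_pairing (negPf b0).
under eq_bigr => a _ do
  under eq_bigr => t _ do rewrite pairingDr ecD.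
under eq_bigr => a _ do rewrite -mulr_sumr.
rewrite -mulr_suml => /eqP; rewrite mulf_eq0.
by case/orP => /eqP; [left | right].
Qed.

(* The number of representations [x = a + s i] has Fourier transform
   supported at [0]. *)
Lemma family_tile (I : finType) (s : I -> G p) A :
  (#|A| * #|I| = p ^ 3)%N ->
  (forall b, b != 0 -> ft A b = 0 \/ \sum_i ec (pairing b (s i)) = 0) ->
  tile A.
Proof.
move=> AI H; exists (s @: I) => x.
pose R := [set u : G p * I | (u.1 \in A) && (u.1 + s u.2 == x)].
have p3 : (p ^ 3)%:R != 0 :> algC by rewrite pnatr_eq0 -lt0n expn_gt0 p_gt0.
have /cards1P[[a i] RE] : #|R| == 1%N.
  rewrite -(eqr_nat algC) -(inj_eq (mulIf p3)) mul1r; apply/eqP.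
  (* The sum over [b] detects [a + s i = x]; after exchanging sums only [b = 0] contributes. *)
  transitivity (\sum_(a in A) \sum_i \sum_b ec (pairing b (a + s i - x))).
    rewrite pair_big /= -sumr_const mulr_suml [RHS](bigID (mem R)) /=.
    rewrite [X in _ + X]big1 ?addr0 => [|[a i]].
      apply: eq_big => [[a i]|[a i]]; rewrite inE /=.
        by case: (a \in A); rewrite ?andbT.
      by case/andP=> _ /eqP <-; rewrite sum_ec_pairing subrr eqxx mul1r.
    rewrite inE /= andbT => /andP[-> /= nx].
    by rewrite sum_ec_pairing subr_eq0 (negPf nx).
  under eq_bigr => a _ do rewrite exchange_big.
  rewrite exchange_big (bigD1 (0 : G p)) //= [X in _ + X]big1 ?addr0.
    under eq_bigr => a _ do
      under eq_bigr => i _ do rewrite pairing0l ec0.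
    by rewrite !sumr_const -mulrnA mulnC AI.
  move=> b b0.
  transitivity (ft A b * (\sum_i ec (pairing b (s i))) * ec (pairing b (- x))).
    rewrite /ft mulr_suml mulr_suml; apply: eq_bigr => a _.
    rewrite mulr_sumr mulr_suml; apply: eq_bigr => i _.
    by rewrite !pairingDr !ecD.
  by case: (H b b0) => ->; rewrite ?mulr0 !mul0r.
have : (a, i) \in R by rewrite RE set11.
rewrite inE /= => /andP[aA /eqP ax].
exists (a, s i); split=> [|[a' t] /= [a'A /imsetP[i' _ ->] ax']].
  by split=> //=; apply: imset_f.
have : (a', i') \in R by rewrite inE /= a'A ax' eqxx.
by rewrite RE inE => /eqP[-> ->].
Qed.

(** * Arithmetic of the zero set *)

(** The coefficients that turn [ft A b] into a sum of powers of one root of unity. *)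
Definition fiber_card A b (i : nat) :=
  #|[set a in A | pairing b a == i :> nat]|.

Lemma sum_fiber A b (F : nat -> algC) :
  \sum_(a in A) F (pairing b a) =
  \sum_(i < p ^ 2) (fiber_card A b i)%:R * F i.
Proof.
under [RHS]eq_bigr => i _ do rewrite -sumr_const mulr_suml big_set.
rewrite (exchange_big_dep (mem A)) /=; last by move=> i a _ /andP[].
apply: eq_bigr => a aA.
have lt : (pairing b a < p ^ 2)%N by have := ltn_ord (pairing b a); rewrite [X in (_ < X)%N]Zp_cast.
rewrite (big_pred1 (Ordinal lt)) ?mul1r // => i.
by rewrite unfold_in aA /= -val_eqE /= eq_sym.
Qed.

(** [ft A (b *+ k)] is a Galois conjugate of [ft A b]. *)
Lemma ft_mulrn A b k : coprime k p -> ft A b = 0 -> ft A (b *+ k) = 0.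
Proof.
move=> kp; rewrite /ft (sum_fiber A b (fun i => eN (p ^ 2) ^+ i)) => b0.
rewrite -[RHS](vanishing_sum_conjugate (f := fiber_card A b) zP b0 kp).
rewrite -(sum_fiber A b (fun i => eN (p ^ 2) ^+ (i * k))).
by apply: eq_bigr => a _; rewrite pairingMnl ecMn -exprM.
Qed.

Lemma pair_mulrn (k : nat) b : b *+ k = (b.1 *+ k, b.2 *+ k).
Proof. by elim: k => // k IH; rewrite !mulrS IH. Qed.

Lemma G_mulrn_dvd b k : (p ^ 2 %| k)%N -> b *+ k = 0.
Proof.
move=> dk; have dk1 : (p %| k)%N by apply: dvdn_trans dk; rewrite dvdn_exp.
rewrite pair_mulrn -mulr_natr -[b.2 *+ k]mulr_natr.
have /eqP -> : (k%:R == 0 :> 'Z_(p ^ 2)) by rewrite natZp_eq0.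
have /eqP -> : (k%:R == 0 :> 'Z_p) by rewrite natZp_eq0.
by rewrite !mulr0.
Qed.

Lemma mulrn_inverse k : coprime k p ->
  exists2 j, coprime j p & forall b, b *+ k *+ j = b.
Proof.
(* By Euler's theorem this power inverts [k] modulo p^2, which annihilates the group. *)
move=> kp; exists (k ^ (totient (p ^ 2)).-1)%N => [|b]; first by rewrite coprimeXl.
rewrite -mulrnA -expnS prednK ?totient_gt0 ?expn_gt0 ?p_gt0 //.
rewrite (divn_eq (k ^ totient (p ^ 2)) (p ^ 2)) Euler_exp_totient ?coprimeXr //.
by rewrite modn_small // mulrnDr (G_mulrn_dvd b (dvdn_mull _ (dvdnn _))) add0r.
Qed.

Lemma mulrn_coprime_eq0 b k : coprime k p -> b *+ k = 0 -> b = 0.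
Proof. by move=> /mulrn_inverse[j _ jK] bk; rewrite -(jK b) bk mul0rn. Qed.

Lemma ft_mulrn_coprime_eq0 A b k : coprime k p -> ft A (b *+ k) = 0 -> ft A b = 0.
Proof. by move=> /mulrn_inverse[j jp jK] /(ft_mulrn jp); rewrite jK. Qed.

(** The fiber sizes are p-periodic, so their sum [#|A|] splits into p equal blocks. *)
Lemma dvdn_card_ft0 A b : ft A b = 0 -> (p %| #|A|)%N.
Proof.
rewrite /ft (sum_fiber A b (fun i => eN (p ^ 2) ^+ i)).
set f := fiber_card A b => f0.
have fP := vanishing_sum_periodic p_pr zP f0.
have blocks m : (m <= p)%N ->
    (\sum_(0 <= i < m * p) f i = m * \sum_(0 <= i < p) f i)%N.
  elim: m => [|m IH] mp; first by rewrite !mul0n big_nil.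
  rewrite [in LHS]mulSnr mulSnr -IH ?(ltnW mp) //.
  rewrite (@big_cat_nat _ _ _ (m * p)) //= ?leq_addr //; congr (_ + _)%N.
  rewrite -{1}[(m * p)%N]add0n big_addn addKn.
  apply: eq_big_nat => i /andP[_ ip].
  elim: m mp {IH} => [|m IH] mp; first by rewrite mul0n addn0.
  rewrite mulSnr addnA fP ?IH // ?(ltnW mp) //.
  rewrite -addnA -mulSnr -mulnn (@leq_trans (m.+2 * p)) ?leq_mul2r ?mp ?orbT //.
  by rewrite [X in (_ < X)%N]mulSn ltn_add2r.
have := sum_fiber A b (fun=> 1); rewrite sumr_const.
under [RHS]eq_bigr => i _ do rewrite mulr1.
rewrite -natr_sum => /eqP; rewrite eqr_nat => /eqP ->.
by rewrite -(big_mkord predT f) -mulnn blocks // dvdn_mulr.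
Qed.

End Fourier.

(** * Classes of elements up to multiples prime to p *)

(* Up to multiples prime to [p], the nonzero elements of [G p] are
   [genC c] (order p^2), [genO u] and [genP] (order p). *)
Definition genC (p : nat) (c : 'Z_p) : G p := (1, c).
Definition genO (p : nat) (u : 'Z_p) : G p := (plift u, 1).
Definition genP (p : nat) : G p := (plift (1 : 'Z_p), 0).

Section Grids.

Variable p : nat.
Hypothesis p_pr : prime p.

Let p_gt0 : (0 < p)%N := prime_gt0 p_pr.
Let p_gt1 : (1 < p)%N := prime_gt1 p_pr.
Let p2_gt1 : (1 < p ^ 2)%N. Proof. by rewrite -(exp1n 2) ltn_exp2r. Qed.

Implicit Types (A B T : {set G p}) (a b x g h t : G p) (c u y : 'Z_p).

Lemma coprime_val y : coprime y p = (y != 0).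
Proof.
by rewrite coprime_sym prime_coprime // -[y in RHS]natr_Zp natZp_eq0.
Qed.

Lemma coprime_unit k : coprime k p -> (k%:R : 'Z_p) \is a GRing.unit.
Proof. by move=> kp; rewrite unitZpE // coprime_sym. Qed.

Lemma mulrn_coprime_neq0 y k : coprime k p -> y != 0 -> y *+ k != 0.
Proof.
move=> kp; apply: contra_neq => yk0; rewrite -[y](mulrK (coprime_unit kp)).
by rewrite mulr_natr yk0 mul0r.
Qed.

Lemma pliftMn y k : plift (y *+ k) = plift y *+ k.
Proof. by elim: k => [|k IH]; rewrite ?plift0 // !mulrS pliftD // IH. Qed.

Lemma pliftM y u : plift y * plift u = 0.
Proof.
apply/eqP; rewrite /plift -natrM natZp_eq0 //.
by rewrite mulnACA mulnn dvdn_mulr.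
Qed.

Lemma plift1 : plift (1 : 'Z_p) = p%:R.
Proof. by rewrite -[1]/(1%:R) plift_nat // muln1. Qed.

Lemma dvdn_val_nat k : (p %| (k%:R : 'Z_(p ^ 2)))%N = (p %| k)%N.
Proof.
rewrite val_Zp_nat // [in RHS](divn_eq k (p ^ 2)) dvdn_addr //.
by rewrite dvdn_mull // dvdn_exp.
Qed.

Lemma genC_class b : ~~ (p %| b.1)%N ->
  exists c k, coprime k p /\ b = genC c *+ k.
Proof.
move=> nb; have bp : coprime b.1 p by rewrite coprime_sym prime_coprime.
exists (b.2 / (b.1 : nat)%:R), b.1; split=> //.
rewrite pair_mulrn /= natr_Zp -[X in (_, X)]mulr_natr divrK ?coprime_unit //.
by case: b {nb bp}.
Qed.

Lemma genOP_class b : (p %| b.1)%N -> b != 0 ->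
  (exists u k, coprime k p /\ b = genO u *+ k) \/
  (exists2 k, coprime k p & b = genP p *+ k).
Proof.
case: b => b1 b2 /= /dvdnP[m b1E] b0.
have {}b1E : b1 = plift (m%:R : 'Z_p) by rewrite plift_nat // -[LHS]natr_Zp b1E mulnC.
have [b20|nb2] := eqVneq b2 0.
  right; exists m; last first.
    by rewrite pair_mulrn /= mul0rn -pliftMn b1E b20.
  rewrite coprime_sym prime_coprime // -natZp_eq0 //.
  by apply: contraNneq b0 => m0; rewrite b1E m0 plift0 b20.
left; have cb := nb2; rewrite -coprime_val in cb.
exists (m%:R / (b2 : nat)%:R), b2; split=> //.
by rewrite pair_mulrn /= -pliftMn -[(_ / _) *+ _]mulr_natr divrK ?coprime_unit // natr_Zp -b1E.
Qed.

(** Being a zero and being killed are stable under multiples prime to p, so both need checking on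
    representatives only. *)
Lemma classes_ind (Q : G p -> Prop) :
  (forall b k, coprime k p -> Q b -> Q (b *+ k)) ->
  (forall c, Q (genC c)) -> (forall u, Q (genO u)) -> Q (genP p) ->
  forall b, b != 0 -> Q b.
Proof.
move=> QM QC QO QP b b0; have [db|nb] := boolP (p %| b.1)%N.
  by case: (genOP_class db b0) => [[u [k [kp ->]]]|[k kp ->]]; apply: QM.
by have [c [k [kp ->]]] := genC_class nb; apply: QM.
Qed.

(** * Tiling complements spanned by one or two elements *)

(* [t] kills [b] when [<b, t>] is a nonzero multiple of [p]; the character [b]
   then sums to zero over [0, t, ..., (p-1) t]. *)
Definition kills t b := exists2 y, y != 0 & pairing b t = plift y.

Lemma kills_mulrn t b k : coprime k p -> kills t b -> kills t (b *+ k).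
Proof.
move=> kp [y y0 yE]; exists (y *+ k); first exact: mulrn_coprime_neq0.
by rewrite pairingMnl // yE pliftMn.
Qed.

Lemma kills_sum t b : kills t b -> \sum_(i < p) ec (pairing b (t *+ i)) = 0.
Proof.
case=> y y0 yE; under eq_bigr => i _ do rewrite pairingMnr // yE ecMn //.
(* A geometric series whose ratio is a p-th root of unity other than 1. *)
have /eqP := subrX1 (ec (plift y)) p.
rewrite -ecMn // -pliftMn -mulr_natr pchar_Zp // mulr0 plift0 ec0 subrr eq_sym.
by rewrite mulf_eq0 subr_eq0 ec_eq1 // plift_eq0 // (negPf y0) => /eqP.
Qed.

Lemma tile_of_kills A t : #|A| = (p ^ 2)%N ->
  (forall b, b != 0 -> ft A b = 0 \/ kills t b) -> tile A.
Proof.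
move=> cA H; apply: (@family_tile _ p_pr _ (fun i : 'I_p => t *+ i)).
  by rewrite cA card_ord -expnSr.
by move=> b /H[]; [left | right; exact: kills_sum].
Qed.

Lemma tile_of_kills2 A t t' : #|A| = p ->
  (forall b, b != 0 -> [\/ ft A b = 0, kills t b | kills t' b]) -> tile A.
Proof.
move=> cA H.
apply: (@family_tile _ p_pr _ (fun i : 'I_p * 'I_p => t *+ i.1 + t' *+ i.2)).
  by rewrite cA card_prod !card_ord mulnn -expnS.
move=> b b0.
have sumE : \sum_(i : 'I_p * 'I_p) ec (pairing b (t *+ i.1 + t' *+ i.2)) =
    (\sum_(i < p) ec (pairing b (t *+ i))) * (\sum_(j < p) ec (pairing b (t' *+ j))).
  rewrite big_distrlr pair_bigA /=.
  by apply: eq_bigr => -[i j] _; rewrite pairingDr // ecD.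
case: (H b b0) => [|/kills_sum E|/kills_sum E]; first by left.
  by right; rewrite sumE E mul0r.
by right; rewrite sumE E mulr0.
Qed.

(** Three shapes of [t] are used: [(- plift c, 1)] kills every [genO u] and all [genC c'] but
    [genC c]; [(1, - u)] kills [genP] and all [genO u'] but [genO u]; [genP] kills every
    [genC c]. *)
Lemma kills_genC_neq c c' : c' != c -> kills (- plift c, 1) (genC c').
Proof.
move=> cc; exists (c' - c); first by rewrite subr_eq0.
by rewrite /pairing /= mul1r mulr1 addrC pliftD // pliftN.
Qed.

Lemma kills_genO c u : kills (- plift c, 1) (genO u).
Proof.
exists 1; rewrite ?oner_neq0 // /pairing /= mulr1 mulrN pliftM oppr0 add0r //.
Qed.

Lemma kills_genO_neq u u' : u' != u -> kills (1, - u) (genO u').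
Proof.
move=> uu; exists (u' - u); first by rewrite subr_eq0.
by rewrite /pairing /= mul1r mulr1 pliftD.
Qed.

Lemma kills_genP u : kills (1, u) (genP p).
Proof. by exists 1; rewrite ?oner_neq0 // /pairing /= mulr1 mul0r plift0 addr0. Qed.

Lemma genP_kills_genC c : kills (genP p) (genC c).
Proof. by exists 1; rewrite ?oner_neq0 // /pairing /= mul1r mulr0 plift0 addr0. Qed.

Lemma zero_scale t A b k : coprime k p ->
  ft A b = 0 \/ kills t b -> ft A (b *+ k) = 0 \/ kills t (b *+ k).
Proof.
by move=> kp [/(ft_mulrn p_pr kp)|/(kills_mulrn kp)]; [left | right].
Qed.

(** With [b] reduced to a representative, [t] and [t'] are chosen to kill together all the other
    classes. *)
Lemma tile_card_p A b : #|A| = p -> ft A b = 0 -> tile A.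
Proof.
move=> cA Ab0; have b0 : b != 0.
  apply/eqP => bE; move: Ab0; rewrite bE ft0 // cA => /eqP.
  by rewrite pnatr_eq0 -leqn0 leqNgt p_gt0.
have scale t t' d k : coprime k p ->
    [\/ ft A d = 0, kills t d | kills t' d] ->
    [\/ ft A (d *+ k) = 0, kills t (d *+ k) | kills t' (d *+ k)].
  move=> kp [/(ft_mulrn p_pr kp)|/(kills_mulrn kp)|/(kills_mulrn kp)].
  - exact: Or31.
  - exact: Or32.
  - exact: Or33.
elim/classes_ind: b / b0 Ab0 => [b k kp IH /(ft_mulrn_coprime_eq0 p_pr kp)/IH //|c|u|] A0.
- apply: (@tile_of_kills2 A (- plift c, 1) (1, 0)) => //.
  apply: classes_ind => [|c'|u|]; first exact: scale.
  + have [->|cc] := eqVneq c' c; first exact: Or31.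
    by apply: Or32; exact: kills_genC_neq.
  + by apply: Or32; exact: kills_genO.
  + by apply: Or33; exact: kills_genP.
- apply: (@tile_of_kills2 A (1, - u) (genP p)) => //.
  apply: classes_ind => [|c'|u'|]; first exact: scale.
  + by apply: Or33; exact: genP_kills_genC.
  + have [->|uu] := eqVneq u' u; first exact: Or31.
    by apply: Or32; exact: kills_genO_neq.
  + by apply: Or32; exact: kills_genP.
- apply: (@tile_of_kills2 A (- plift 0, 1) (genP p)) => //.
  apply: classes_ind => [|c'|u'|]; first exact: scale.
  + by apply: Or33; exact: genP_kills_genC.
  + by apply: Or32; exact: kills_genO.
  + exact: Or31.
Qed.

(** * Grids of p^2 elements and their differences *)

(** Adding [p ^ 2], which annihilates the group, makes the difference a natural multiple, to which
    stability of zeros applies. *)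
Lemma mulrn_sub b (i j : 'I_p) : b *+ i - b *+ j = b *+ (i + (p ^ 2 - j)).
Proof.
have jp : (j <= p ^ 2)%N by rewrite (leq_trans (ltnW (ltn_ord j))) // -mulnn leq_pmulr.
apply/eqP; rewrite mulrnDr subr_eq -addrA -mulrnDr subnK //.
by rewrite [b *+ p ^ 2]G_mulrn_dvd // addr0.
Qed.

Lemma coprime_ord_sub (i j : 'I_p) : i != j -> coprime (i + (p ^ 2 - j)) p.
Proof.
move=> ij; rewrite coprime_sym prime_coprime //; apply: contra ij => dv.
have jp : (j <= p ^ 2)%N by rewrite (leq_trans (ltnW (ltn_ord j))) // -mulnn leq_pmulr.
have : (i + (p ^ 2 - j) + j = i + p ^ 2)%N by rewrite -addnA subnK.
move/(congr1 (modn^~ p)); rewrite -modnDml (eqP dv) add0n -mulnn [(i + _)%N]addnC modnMDl.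
by rewrite !modn_small // => E; apply/eqP/val_inj.
Qed.

Definition grid g h (i : 'I_p * 'I_p) : G p := g *+ i.1 + h *+ i.2.

Lemma grid_sub g h i j : i != j ->
  (exists k l, coprime k p /\ grid g h i - grid g h j = g *+ k + h *+ l) \/
  (exists2 l, coprime l p & grid g h i - grid g h j = h *+ l).
Proof.
case: i j => [i i'] [j j'] ne; rewrite /grid /= opprD addrACA !mulrn_sub.
have [ij|ij] := eqVneq i j; last first.
  by left; exists (i + (p ^ 2 - j))%N, (i' + (p ^ 2 - j'))%N; rewrite coprime_ord_sub.
right; exists (i' + (p ^ 2 - j'))%N; last by rewrite -mulrn_sub ij subrr add0r.
by apply: coprime_ord_sub; apply: contraNneq ne => ->; rewrite ij.
Qed.

(** The two clauses match the two kinds of differences in [grid_sub]; multiples of [h] follow from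
    [h] itself. *)
Definition zero_grid A g h :=
  (forall k l, coprime k p -> ft A (g *+ k + h *+ l) = 0) /\ ft A h = 0.

Lemma zero_grid_sub A g h i j : zero_grid A g h -> i != j ->
  ft A (grid g h i - grid g h j) = 0.
Proof.
case=> gZ hZ /(grid_sub g h)[[k [l [kp ->]]]|[l lp ->]]; first exact: gZ.
exact: ft_mulrn.
Qed.

Lemma card_grid : #|{: 'I_p * 'I_p}| = (p ^ 2)%N.
Proof. by rewrite card_prod !card_ord mulnn. Qed.

Lemma spectral_family (I : finType) (s : I -> G p) A :
  A != set0 -> #|I| = #|A| ->
  (forall i j, i != j -> ft A (s i - s j) = 0) -> spectral_set A.
Proof.
move=> A0 IA /(orth_family A0)[ort cs]; split=> //; exists (s @: I).
by apply: orth_spectrum => //; rewrite cs.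
Qed.

Definition hits A := forall s : 'I_p * 'I_p -> G p, injective s ->
  exists i j, i != j /\ ft A (s i - s j) = 0.

Lemma hits_grid A g h : hits A ->
  (forall k l, coprime k p -> g *+ k + h *+ l != 0) -> h != 0 ->
  (exists k l, coprime k p /\ ft A (g *+ k + h *+ l) = 0) \/ ft A h = 0.
Proof.
move=> hA gN hN.
have inj : injective (grid g h).
  move=> i j ij; apply/eqP; apply/negPn/negP => /(grid_sub g h).
  rewrite ij subrr => -[[k [l [kp /esym/eqP]]]|[l lp /esym E]].
    exact/negP/gN.
  by move/eqP: hN; apply; apply: mulrn_coprime_eq0 E.
have [i [j [/(grid_sub g h)]]] := hA _ inj.
move=> [[k [l [kp ->]]]|[l lp ->]] E; first by left; exists k, l.
by right; exact: ft_mulrn_coprime_eq0 E.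
Qed.

Lemma genCO_fst c k u l : (genC c *+ k + genO u *+ l).1 = (k + p * (u * l))%:R.
Proof.
rewrite !pair_mulrn /= natrD; congr (_ + _).
by rewrite /plift -mulrnA mulnA.
Qed.

Lemma genCO_ndvd c u k l :
  coprime k p -> ~~ (p %| (genC c *+ k + genO u *+ l)%R.1)%N.
Proof.
move=> kp; rewrite genCO_fst dvdn_val_nat dvdn_addl ?dvdn_mulr //.
by rewrite -prime_coprime // coprime_sym.
Qed.

(** Since [genP p] is [genC c *+ p], this grid is the cyclic group generated by [genC c]. *)
Lemma genCP_mulrn c k l : genC c *+ k + genP p *+ l = genC c *+ (k + p * l).
Proof.
rewrite mulrnDr mulrnA; congr (_ + _ *+ l).
by rewrite pair_mulrn /= /genP plift1 -[c *+ p]mulr_natr pchar_Zp // mulr0.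
Qed.

Lemma coprime_addMl k l : coprime k p -> coprime (k + p * l) p.
Proof.
by rewrite ![coprime _ p]coprime_sym !prime_coprime // dvdn_addl // dvdn_mulr.
Qed.

Lemma genC_neq0 c : genC c != 0.
Proof. by []. Qed.

Lemma genO_neq0 u : genO u != 0.
Proof. by apply/eqP => -[_]. Qed.

Lemma genP_neq0 : genP p != 0.
Proof. by apply/eqP => -[/eqP]; rewrite plift_eq0. Qed.

(** This grid is the p-torsion subgroup, whose nonzero elements lie in the classes of [genO] and
    [genP]. *)
Lemma genPO_sum k l :
  genP p *+ k + genO 0 *+ l = (plift (k%:R : 'Z_p), l%:R).
Proof.
rewrite !pair_mulrn; congr (_, _); rewrite /= ?mul0rn ?add0r //.
by rewrite plift0 mul0rn addr0 -pliftMn.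
Qed.

Lemma genPO_neq0 k l : coprime k p -> genP p *+ k + genO 0 *+ l != 0.
Proof.
move=> kp; rewrite genPO_sum; apply/eqP => -[/eqP].
by rewrite plift_eq0 // natZp_eq0 // => dv; move: kp; rewrite coprime_sym prime_coprime // dv.
Qed.

Lemma genPO_dvd k l : (p %| (genP p *+ k + genO 0 *+ l)%R.1)%N.
Proof. by rewrite genPO_sum /= plift_nat // dvdn_val_nat dvdn_mulr. Qed.

(** Three grids give three dichotomies: each [genC c] or else [genP] is a zero; [genP] or some
    [genO u] is; some [genC c] or else every [genO u] is. In each resulting case a [t] kills the
    classes not known to be zeros. *)
Lemma hits_cases A : hits A ->
  exists g h t, zero_grid A g h /\ forall b, b != 0 -> ft A b = 0 \/ kills t b.
Proof.
move=> hA.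
have caseCP c : ft A (genC c) = 0 \/ ft A (genP p) = 0.
  have [||[k [l [kp]]]|] := @hits_grid A (genC c) (genP p) hA; last by right.
  - move=> k l kp; rewrite genCP_mulrn; apply/eqP => E.
    have /eqP := mulrn_coprime_eq0 p_pr (coprime_addMl l kp) E.
    by rewrite (negPf (genC_neq0 c)).
  - exact: genP_neq0.
  rewrite genCP_mulrn => /(ft_mulrn_coprime_eq0 p_pr (coprime_addMl l kp)).
  by left.
have caseOP : ft A (genP p) = 0 \/ exists u, ft A (genO u) = 0.
  have [||[k [l [kp E]]]|E] := @hits_grid A (genP p) (genO 0) hA.
  - exact: genPO_neq0.
  - exact: genO_neq0.
  - case: (genOP_class (genPO_dvd k l) (genPO_neq0 l kp)).
      move=> [u [m [mp bE]]]; right; exists u; move: E; rewrite bE.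
      exact: ft_mulrn_coprime_eq0.
    by move=> [m mp bE]; left; move: E; rewrite bE; exact: ft_mulrn_coprime_eq0.
  - by right; exists 0.
have caseCO u : (exists c, ft A (genC c) = 0) \/ ft A (genO u) = 0.
  have [||[k [l [kp E]]]|E] := @hits_grid A (genC 0) (genO u) hA; last by right.
  - move=> k l kp; apply/eqP => E; have := genCO_ndvd 0 u l kp.
    by rewrite E dvdn0.
  - exact: genO_neq0.
  left; have [c [m [mp bE]]] := genC_class (genCO_ndvd 0 u l kp).
  by exists c; move: E; rewrite bE; exact: ft_mulrn_coprime_eq0.
have gridCP c : ft A (genC c) = 0 -> ft A (genP p) = 0 ->
    exists g h t, zero_grid A g h /\ forall b, b != 0 -> ft A b = 0 \/ kills t b.
  move=> c0 P0; exists (genC c), (genP p), (- plift c, 1); split.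
    split=> // k l kp; rewrite genCP_mulrn.
    by apply: ft_mulrn => //; exact: coprime_addMl.
  apply: classes_ind => [b k kp|c'|u|]; [exact: zero_scale| | |by left].
    have [->|cc] := eqVneq c' c; first by left.
    by right; exact: kills_genC_neq.
  by right; exact: kills_genO.
have [/forallP allC|] := boolP [forall c, ft A (genC c) == 0].
  (* When every [genC c] is a zero, one zero of order p completes a grid. *)
  case: caseOP => [P0|[u u0]]; first exact: (gridCP 0 (eqP (allC 0))).
  exists (genC 0), (genO u), (1, - u); split.
    split=> // k l kp; have [c [m [mp ->]]] := genC_class (genCO_ndvd 0 u l kp).
    by apply: ft_mulrn => //; exact/eqP.
  apply: classes_ind => [b k kp|c'|u'|]; [exact: zero_scale| | |].
  - by left; exact/eqP.
  - have [->|uu] := eqVneq u' u; first by left.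
    by right; exact: kills_genO_neq.
  - by right; exact: kills_genP.
rewrite negb_forall => /existsP[c0 /eqP c0N].
have P0 : ft A (genP p) = 0 by case: (caseCP c0).
have [/existsP[c /eqP cZ]|] := boolP [exists c, ft A (genC c) == 0].
  exact: gridCP cZ P0.
rewrite negb_exists => /forallP noC.
have allO u : ft A (genO u) = 0.
  by case: (caseCO u) => // -[c /eqP cZ]; have := noC c; rewrite cZ.
(* With no zero among the [genC c], the p-torsion is the grid, and [genP p] kills the rest. *)
exists (genP p), (genO 0), (genP p); split.
  split=> // k l kp; case: (genOP_class (genPO_dvd k l) (genPO_neq0 l kp)).
    by move=> [u [m [mp ->]]]; exact: ft_mulrn.
  by move=> [m mp ->]; exact: ft_mulrn.
apply: classes_ind => [b k kp|c'|u'|]; [exact: zero_scale| | |by left].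
  by right; exact: genP_kills_genC.
by left.
Qed.

(** * The two implications *)

(** The differences [b - s i] cannot be distinct in a group of order p^3. *)
Lemma pigeonhole_sub (I : finType) (s : I -> G p) B : (p ^ 3 < #|B| * #|I|)%N ->
  exists i j b b', [/\ i != j, b \in B, b' \in B & s i - s j = b - b'].
Proof.
move=> lt; have /injectivePn[[b i] [[b' j] ne E]] :
    ~~ injectiveb (fun u : {b | b \in B} * I => val u.1 - s u.2).
  apply/negP => /injectiveP/leq_card.
  by rewrite card_prod card_sig card_G // leqNgt lt.
have {}E : val b = val b' - s j + s i by rewrite -E subrK.
exists i, j, (val b), (val b'); split; [|exact: valP|exact: valP|].
  apply: contraNneq ne => ij; apply/eqP; congr (_, _) => //.
  by apply: val_inj; rewrite E ij subrK.
by rewrite E [RHS]addrC !addrA addNr add0r addrC.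
Qed.

Lemma ft_setT b : b != 0 -> ft [set: G p] b = 0.
Proof.
move=> b0; transitivity (\sum_x ec (pairing x b)).
  by apply: eq_big => x; rewrite ?inE // pairingC.
by rewrite sum_ec_pairing // (negPf b0).
Qed.

(** The whole group is then orthogonal on [A], so the bound [orth_card] applies to it. *)
Lemma all_zero_card A : A != set0 -> (forall b, b != 0 -> ft A b = 0) ->
  #|A| = (p ^ 3)%N.
Proof.
move=> A0 H; apply/eqP; rewrite eqn_leq -card_G // max_card /= -cardsT.
by apply: (orth_card p_pr A0) => b b' _ _ bb'; rewrite H // subr_eq0.
Qed.

Lemma spectral_tile A : spectral_set A -> tile A.
Proof.
case=> A0 [B /(spectrum_orth p_pr A0)[AB cB]].
have [A1|A_gt1] := leqP #|A| 1.
  apply: (@family_tile _ p_pr (G p) id).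
    have /eqP -> : #|A| == 1%N by rewrite eqn_leq A1 card_gt0.
    by rewrite mul1n card_G.
  move=> b b0; right; apply: etrans (ft_setT b0).
  by apply: eq_bigl => x; rewrite inE.
have [b [b' [bB b'B bb']]] : exists b b', [/\ b \in B, b' \in B & b != b'].
  by apply/card_gt1P; rewrite cB.
have pA := dvdn_card_ft0 p_pr (AB _ _ bB b'B bb').
have [Ap|pA1] := leqP #|A| p.
  apply: (tile_card_p _ (AB _ _ bB b'B bb')).
  by apply/eqP; rewrite eqn_leq Ap dvdn_leq // card_gt0.
have hA : hits A.
  move=> s inj; have [|i [j [d [d' [ij dB d'B E]]]]] := @pigeonhole_sub _ s B.
    by rewrite cB card_grid [(p ^ 3)%N]expnS ltn_pmul2r // expn_gt0 p_gt0.
  exists i, j; split=> //; rewrite E; apply: AB => //.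
  by apply: contraNneq ij => dd; apply/eqP/inj/eqP; rewrite -subr_eq0 E dd subrr.
have [g [h [t [gh kt]]]] := hits_cases hA.
have [ort cs] := orth_family A0 (fun i j => zero_grid_sub gh (i := i) (j := j)).
have := orth_card p_pr A0 ort; rewrite cs card_grid leq_eqVlt.
case/predU1P => [/esym cA|A_big]; first exact: tile_of_kills cA kt.
(* Beyond p^2 elements, the pigeonhole works already with the p multiples of [b0], so every nonzero
   [b0] is a zero and [A] is the whole group. *)
have Az b0 : b0 != 0 -> ft A b0 = 0.
  move=> nb0; have [|i [j [d [d' [ij dB d'B E]]]]] :=
    @pigeonhole_sub _ (fun i : 'I_p => b0 *+ i) B.
    by rewrite cB card_ord expnSr ltn_pmul2r.
  move: E; rewrite mulrn_sub => E; have co := coprime_ord_sub ij.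
  apply: (ft_mulrn_coprime_eq0 p_pr co); rewrite E; apply: AB => //.
  apply: contraNneq nb0 => dd; apply/eqP/(mulrn_coprime_eq0 p_pr co).
  by rewrite E dd subrr.
apply: (@family_tile _ p_pr unit (fun=> 0)) => [|d d0].
  by rewrite card_unit muln1 all_zero_card.
by left; exact: Az.
Qed.

Lemma tile_spectral A : tile A -> spectral_set A.
Proof.
case/(tile_card_ft p_pr) => T [cAT AT].
have A0 : A != set0.
  apply/eqP => E; move: cAT; rewrite E cards0 mul0n => /esym/eqP.
  by rewrite expn_eq0 (gtn_eqF p_gt0).
have T0 : T != set0.
  apply/eqP => E; move: cAT; rewrite E cards0 muln0 => /esym/eqP.
  by rewrite expn_eq0 (gtn_eqF p_gt0).
have /(dvdn_pfactor _ _ p_pr)[m m3 cA] : (#|A| %| p ^ 3)%N.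
  by rewrite -cAT dvdn_mulr.
have cT : #|T| = (p ^ (3 - m))%N.
  have pm : (0 < p ^ m)%N by rewrite expn_gt0 p_gt0.
  by apply/eqP; rewrite -(eqn_pmul2l pm) -expnD subnKC // -cAT cA.
case: m m3 cA cT => [|[|[|[|//]]]] _ cA cT.
- apply: (@spectral_family unit (fun=> 0)) => //.
  by rewrite card_unit cA.
- have /existsP[b /andP[b0 /eqP Ab]] : [exists b : G p, (b != 0) && (ft A b == 0)].
    (* Otherwise [ft T] vanishes at every nonzero [b], and [T] has p^3 elements instead of p^2. *)
    apply: contraT; rewrite negb_exists => /forallP no.
    have : #|T| = (p ^ 3)%N.
      apply: all_zero_card => // b b0; case: (AT b b0) => // /eqP Ab.
      by have := no b; rewrite b0 Ab.
    by rewrite cT => /eqP; rewrite eqn_exp2l.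
  apply: (@spectral_family _ (fun i : 'I_p => b *+ i)) => //.
    by rewrite card_ord cA.
  by move=> i j ij; rewrite mulrn_sub; apply: ft_mulrn => //; exact: coprime_ord_sub.
- have hA : hits A.
    move=> s inj.
    have /existsP[i /existsP[j /andP[ij /eqP E]]] :
        [exists i, exists j, (i != j) && (ft A (s i - s j) == 0)].
      (* Otherwise [s] gives p^2 characters orthogonal on [T], which has only p elements. *)
      apply: contraT; rewrite negb_exists => /forallP no.
      have [] := @orth_family _ _ s T T0.
        move=> i j ij; have := no i; rewrite negb_exists => /forallP/(_ j).
        rewrite ij /= => nA; case: (AT (s i - s j)) => // [|/eqP].
          by rewrite subr_eq0 (inj_eq inj).
        by rewrite (negPf nA).
      move=> ort cs; have := orth_card p_pr T0 ort.
      by rewrite cs card_grid cT leq_exp2l.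
    by exists i, j.
  have [g [h [_ [gh _]]]] := hits_cases hA.
  apply: (@spectral_family _ (grid g h)) => //; first by rewrite card_grid cA.
  by move=> i j; exact: zero_grid_sub.
- have AE : A = [set: G p].
    by apply/eqP; rewrite eqEcard subsetT cardsT card_G // cA leqnn.
  apply: (@spectral_family (G p) id) => //; first by rewrite card_G // cA.
  by move=> b b' bb'; rewrite AE ft_setT // subr_eq0.
Qed.

End Grids.

Theorem theorem1p2 (p : nat) (hp : prime p) (A : {set G p}) :
  spectral_set A <-> tile A.
Proof. by split; [apply: spectral_tile | apply: tile_spectral]. Qed.
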